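(* Let $0\le\mu<L<+\infty$, $N\ge1$, $R>0$, let $H=\{h_{i,k}\}$ define a fixed-step method with $N$ steps such that $h_{i,i-1}\neq0$ for all $i\in\{1,\dots,N\}$, and let $b\in\mathbb{R}^{N+1}$, $C\in\mathbb{S}^{N+2}$. Then the optimal value of the dual problem $$\inf_{\{\lambda_{ij}\}_{i,j\in I},\ \tau}\ \tau R^2\quad\text{s.t.}\quad \tau A_R-C+\sum_{i,j\in I}\lambda_{ij}A_{ij}\succeq0,\quad b-\sum_{i,j\in I}\lambda_{ij}(v_j-v_i)=0,\quad \lambda_{ij}\ge0\ (i,j\in I),\quad \tau\ge0$$ is attained and equal to $w^{sdp}_{\mu,L}(R,H,N,b,C)$.
   Context: Fixed-step method with $N$ steps: scalars $h_{i,k}$ for $1\le i\le N$, $0\le k\le N-1$, with $h_{i,k}=0$ for $k\ge i$ (a lower-triangular $H\in\mathbb{R}^{N\times N}$); iterates are $x_i=x_0-\sum_{k=0}^{i-1}h_{i,k}g_k$ with $g_k$ the gradient at $x_k$. Let $I=\{0,1,\dots,N,*\}$ and $e_1,\dots,e_{N+2}$ the standard basis of $\mathbb{R}^{N+2}$. For $i=0,\dots,N$ let $h_i=(-h_{i,0},\dots,-h_{i,i-1},0,\dots,0,1)^{\top}\in\mathbb{R}^{N+2}$ (last entry $1$) and $u_i=e_{i+1}$; let $h_*=u_*=0$. For $i,j\in I$ define the symmetric matrix $A_{ij}$ by $2A_{ij}=\frac{L}{L-\mu}\big(u_j(h_i-h_j)^{\top}+(h_i-h_j)u_j^{\top}\big)+\frac{1}{L-\mu}(u_i-u_j)(u_i-u_j)^{\top}+\frac{\mu}{L-\mu}\big(u_i(h_j-h_i)^{\top}+(h_j-h_i)u_i^{\top}\big)+\frac{L\mu}{L-\mu}(h_i-h_j)(h_i-h_j)^{\top}$,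 and $A_R=e_{N+2}e_{N+2}^{\top}$. For the function-value variables, let $v_i$ be the $(i+1)$-th standard basis vector of $\mathbb{R}^{N+1}$ for $i=0,\dots,N$ and $v_*=0$. The primal value $w^{sdp}_{\mu,L}(R,H,N,b,C)$ is the supremum of $b^{\top}f+\mathrm{Tr}(CG)$ over $G\in\mathbb{S}^{N+2}$ (symmetric matrices), $f=(f_0,\dots,f_N)\in\mathbb{R}^{N+1}$ subject to $f_j-f_i+\mathrm{Tr}(GA_{ij})\le0$ for all $i,j\in I$ (with $f_*:=0$), $\mathrm{Tr}(GA_R)\le R^2$, and $G\succeq0$. *)

(* Defs.v *)
From HB Require Import structures.
From mathcomp Require Import all_boot all_order all_algebra.
From mathcomp Require Import classical_sets reals constructive_ereal ereal.
Set Implicit Arguments. Unset Strict Implicit. Unset Printing Implicit Defensive.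
Import Order.TTheory GRing.Theory Num.Theory.
Local Open Scope ring_scope.
Local Open Scope classical_set_scope.

Section PEP.
Variable R : realType.

(* Index set I = {0,...,N,*}: Some i for i in 0..N, None for *. *)
Definition idx (N : nat) := option 'I_N.+1.

(* h_{i,k} read from the lower-triangular matrix H in R^{N x N}:
   row i-1, column k (i in 1..N, k in 0..N-1); 0 outside this range. *)
Definition hc (N : nat) (H : 'M[R]_N) (i k : nat) : R :=
  match (insub i.-1 : option 'I_N), (insub k : option 'I_N) with
  | Some a, Some b => H a b
  | _, _ => 0
  end.

Definition hvec (N : nat) (H : 'M[R]_N) (i : idx N) : 'cV[R]_(N.+2) :=
  match i with
  | None => 0
  | Some i => \col_(j < N.+2)
      (if j == ord_max then 1
       else if (j < i)%N then - hc H i j else 0)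
  end.

Definition uvec (N : nat) (i : idx N) : 'cV[R]_(N.+2) :=
  match i with
  | None => 0
  | Some i => \col_(j < N.+2) ((j == i :> nat)%:R)
  end.

Definition vvec (N : nat) (i : idx N) : 'cV[R]_(N.+1) :=
  match i with
  | None => 0
  | Some i => \col_(j < N.+1) ((j == i)%:R)
  end.

Definition Amat (mu L : R) (N : nat) (H : 'M[R]_N) (i j : idx N)
  : 'M[R]_(N.+2) :=
  let hi := hvec H i in let hj := hvec H j in
  let ui := uvec i in let uj := uvec j in
  2^-1 *:
  ( (L / (L - mu)) *: (uj *m (hi - hj)^T + (hi - hj) *m uj^T)
  + (1 / (L - mu)) *: ((ui - uj) *m (ui - uj)^T)
  + (mu / (L - mu)) *: (ui *m (hj - hi)^T + (hj - hi) *m ui^T)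
  + (L * mu / (L - mu)) *: ((hi - hj) *m (hi - hj)^T) ).

Definition AR (N : nat) : 'M[R]_(N.+2) := delta_mx ord_max ord_max.

Definition psd (n : nat) (M : 'M[R]_n) : Prop :=
  M^T = M /\ forall x : 'cV[R]_n, 0 <= (x^T *m M *m x) 0 0.

Definition fval (N : nat) (f : 'cV[R]_(N.+1)) (i : idx N) : R :=
  match i with None => 0 | Some i => f i 0 end.

Definition primal_feasible (mu L Rad : R) (N : nat) (H : 'M[R]_N)
  (G : 'M[R]_(N.+2)) (f : 'cV[R]_(N.+1)) : Prop :=
  [/\ forall i j : idx N, fval f j - fval f i + \tr (G *m Amat mu L H i j) <= 0,
      \tr (G *m AR N) <= Rad ^+ 2
    & psd G].

Definition primal_obj (N : nat) (b : 'cV[R]_(N.+1)) (C : 'M[R]_(N.+2))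
  (G : 'M[R]_(N.+2)) (f : 'cV[R]_(N.+1)) : R :=
  (b^T *m f) 0 0 + \tr (C *m G).

Definition w_sdp (mu L Rad : R) (N : nat) (H : 'M[R]_N)
  (b : 'cV[R]_(N.+1)) (C : 'M[R]_(N.+2)) : \bar R :=
  ereal_sup [set (primal_obj b C Gf.1 Gf.2)%:E
            | Gf in [set Gf | primal_feasible mu L Rad H Gf.1 Gf.2]].

Definition dual_feasible (mu L : R) (N : nat) (H : 'M[R]_N)
  (b : 'cV[R]_(N.+1)) (C : 'M[R]_(N.+2))
  (lam : idx N -> idx N -> R) (tau : R) : Prop :=
  [/\ psd (tau *: AR N - C + \sum_(i : idx N) \sum_(j : idx N) lam i j *: Amat mu L H i j),
      b - \sum_(i : idx N) \sum_(j : idx N) lam i j *: (vvec j - vvec i) = 0,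
      forall i j, 0 <= lam i j
    & 0 <= tau].

End PEP.

(* Main.v *)
Require Import Defs.
From HB Require Import structures.
From mathcomp Require Import all_boot all_order all_algebra.
From mathcomp Require Import classical_sets reals constructive_ereal ereal.
From mathcomp Require Import ring lra.
Import Order.TTheory GRing.Theory Num.Theory.
Local Open Scope ring_scope.
Set Implicit Arguments. Unset Strict Implicit. Unset Printing Implicit Defensive.

(** Weak duality is the nonnegativity of [\tr (D *m G)] for positive semidefinite [D], [G].
For the converse, homogenise the primal problem to the convex cone of triples [(t, G, f)] with
[0 <= t] and [G] positive semidefinite, and dualise the remaining scalar constraints one at a
time; no semidefinite multiplier is needed, because testing the resulting Lagrangian inequality
on [G = x x^T] already gives the dual matrix inequality.  Hence it suffices that the scalar
constraints with [i <> j] are strictly satisfiable by some positive semidefinite [G], possibly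
of rank one.  Such a point comes from the method run on the one-dimensional quadratic
[kappa / 2 * x ^ 2] with [mu < kappa < L]: its iterates are [p_i(kappa) x_0] with [p_i] of
degree exactly [i] (this uses [h_{i,i-1} <> 0]), so they are distinct and nonzero for all but
finitely many [kappa].  The primal value is finite since each gradient is bounded by
[L + mu] times the distance of its iterate to the minimiser, and each iterate is a combination
of the starting point and earlier gradients. *)

(** * Bilinear forms and positive semidefinite matrices *)

Definition bil (R : realType) (n : nat) (G : 'M[R]_n) (x y : 'cV[R]_n) : R :=
  (x^T *m G *m y) 0 0.

Lemma bilDl (R : realType) n (G : 'M[R]_n) x y z :
  bil G (x + y) z = bil G x z + bil G y z.
Proof. by rewrite /bil linearD !mulmxDl mxE. Qed.

Lemma bilDr (R : realType) n (G : 'M[R]_n) x y z :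
  bil G x (y + z) = bil G x y + bil G x z.
Proof. by rewrite /bil mulmxDr mxE. Qed.

Lemma bilZl (R : realType) n (G : 'M[R]_n) a x y : bil G (a *: x) y = a * bil G x y.
Proof. by rewrite /bil linearZ -!scalemxAl mxE. Qed.

Lemma bilZr (R : realType) n (G : 'M[R]_n) a x y : bil G x (a *: y) = a * bil G x y.
Proof. by rewrite /bil -scalemxAr mxE. Qed.

Lemma bilNl (R : realType) n (G : 'M[R]_n) x y : bil G (- x) y = - bil G x y.
Proof. by rewrite -scaleN1r bilZl mulN1r. Qed.

Lemma bilNr (R : realType) n (G : 'M[R]_n) x y : bil G x (- y) = - bil G x y.
Proof. by rewrite -scaleN1r bilZr mulN1r. Qed.

Lemma bil0l (R : realType) n (G : 'M[R]_n) x : bil G 0 x = 0.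
Proof. by rewrite /bil trmx0 !mul0mx mxE. Qed.

Lemma bil0r (R : realType) n (G : 'M[R]_n) x : bil G x 0 = 0.
Proof. by rewrite /bil mulmx0 mxE. Qed.

Lemma bil_sym (R : realType) n (G : 'M[R]_n) x y : G^T = G -> bil G x y = bil G y x.
Proof.
move=> sG; rewrite /bil -[LHS]/(_ 0 0) -[in LHS](trmxK (_ *m y)) mxE.
by rewrite !trmx_mul trmxK sG mulmxA.
Qed.

Lemma bil_delta (R : realType) n (G : 'M[R]_n) i j :
  bil G (delta_mx i 0) (delta_mx j 0) = G i j.
Proof. by rewrite /bil trmx_delta -rowE -colE !mxE. Qed.

Lemma trace_mul_rank1 (R : realType) n (G : 'M[R]_n) (u v : 'cV[R]_n) :
  \tr (G *m (u *m v^T)) = bil G v u.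
Proof. by rewrite mulmxA mxtrace_mulC mulmxA trace_mx11. Qed.

Lemma bil_rank1 (R : realType) n (z x y : 'cV[R]_n) :
  bil (z *m z^T) x y = (z^T *m x) 0 0 * (z^T *m y) 0 0.
Proof.
rewrite /bil !mulmxA -mulmxA [x^T *m z]mx11_scalar mul_scalar_mx mxE; congr (_ * _).
by rewrite -[x^T *m z]trmxK mxE trmx_mul trmxK.
Qed.

Lemma psd_rank1 (R : realType) n (z : 'cV[R]_n) : psd (z *m z^T).
Proof.
split; first by rewrite trmx_mul trmxK.
by move=> x; rewrite -/(bil _ x x) bil_rank1 -expr2 sqr_ge0.
Qed.

Lemma psd_zero (R : realType) n : psd (0 : 'M[R]_n).
Proof. by split=> [|x]; rewrite ?trmx0 // mulmx0 mul0mx mxE. Qed.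

Lemma bil_mxD (R : realType) n (G G' : 'M[R]_n) x y :
  bil (G + G') x y = bil G x y + bil G' x y.
Proof. by rewrite /bil mulmxDr mulmxDl mxE. Qed.

Lemma bil_mxZ (R : realType) n a (G : 'M[R]_n) x y :
  bil (a *: G) x y = a * bil G x y.
Proof. by rewrite /bil -scalemxAr -scalemxAl mxE. Qed.

Lemma psdD (R : realType) n (G G' : 'M[R]_n) : psd G -> psd G' -> psd (G + G').
Proof.
move=> [sG pG] [sG' pG']; split; first by rewrite linearD /= sG sG'.
by move=> x; rewrite -/(bil _ x x) bil_mxD addr_ge0 ?pG ?pG'.
Qed.

Lemma psdZ (R : realType) n a (G : 'M[R]_n) : 0 <= a -> psd G -> psd (a *: G).
Proof.
move=> a0 [sG pG]; split; first by rewrite linearZ /= sG.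
by move=> x; rewrite -/(bil _ x x) bil_mxZ mulr_ge0 ?pG.
Qed.

Lemma psd_bilD_le (R : realType) n (G : 'M[R]_n) x y :
  psd G -> bil G (x + y) (x + y) <= 2 * bil G x x + 2 * bil G y y.
Proof.
move=> [sG pG]; have := pG (x - y); rewrite -/(bil _ _ _).
by rewrite !(bilDl, bilDr, bilNl, bilNr) (bil_sym y x sG); lra.
Qed.

(** A crude form of Cauchy-Schwarz, read off from the form at [x + y] and [x - y]. It suffices for
    boundedness, and it shows that a zero diagonal forces a zero matrix. *)
Lemma psd_bil_le (R : realType) n (G : 'M[R]_n) x y :
  psd G -> `|bil G x y| <= bil G x x + bil G y y.
Proof.
move=> [sG pG]; have := pG (x - y); have := pG (x + y).
have := pG x; have := pG y; rewrite -!/(bil _ _ _).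
rewrite !(bilDl, bilDr, bilNl, bilNr) (bil_sym y x sG) => ? ? ? ?.
by rewrite ler_norml; apply/andP; split; lra.
Qed.

Lemma psd_diag_eq0 (R : realType) n (G : 'M[R]_n) :
  psd G -> (forall i, G i i = 0) -> G = 0.
Proof.
move=> pG d0; apply/matrixP => i j; rewrite mxE.
have := psd_bil_le (delta_mx i 0) (delta_mx j 0) pG.
by rewrite !bil_delta !d0 addr0 normr_le0 => /eqP.
Qed.

Lemma psd_diag_ge0 (R : realType) n (G : 'M[R]_n) i : psd G -> 0 <= G i i.
Proof. by move=> [_ pG]; rewrite -bil_delta; apply: pG. Qed.

(** The form of this Schur complement at [x] is the minimum of the form of [G] over all shifts of
    [x] along the [k]-th basis vector. *)
Lemma psd_schur (R : realType) n (G : 'M[R]_n) k : psd G -> G k k != 0 ->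
  psd (G - (G k k)^-1 *: (col k G *m (col k G)^T)).
Proof.
move=> [sG pG] nz; have gk : 0 < G k k by rewrite lt_def nz psd_diag_ge0.
split; first by rewrite linearB linearZ /= trmx_mul trmxK sG.
move=> x; rewrite -/(bil _ x x) bil_mxD -scaleNr bil_mxZ bil_rank1.
set c := (_ *m x) 0 0.
have cE : bil G (delta_mx k 0) x = c by rewrite /bil /c tr_col sG trmx_delta -rowE.
have := pG (x - (c / G k k) *: delta_mx k 0); rewrite -/(bil _ _ _).
rewrite !(bilDl, bilDr, bilNl, bilNr, bilZl, bilZr) (bil_sym x (delta_mx _ _) sG).
rewrite cE bil_delta; set q := bil G x x.
suff -> : q + - (c / G k k * c) + (- (c / G k k * c) + - (c / G k k * - (c / G k k * G k k)))
  = q + - (G k k)^-1 * (c * c) by [].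
by field.
Qed.

(** Symmetric elimination writes [G] as a sum of nonnegative multiples of matrices [z *m z^T], and
    the trace of [D] against such a matrix is the form of [D] at [z]. *)
Lemma psd_trace_ge0 (R : realType) n (D G : 'M[R]_n) :
  (forall x, 0 <= bil D x x) -> psd G -> 0 <= \tr (D *m G).
Proof.
move=> pD pG.
(* Induction on a bound [m] for the indices with nonzero diagonal entry. A Schur step at index [m]
   of the bound [m.+1] clears that entry, and zero diagonal entries stay zero because the diagonal
   can only decrease while remaining nonnegative. *)
suff gen m : (m <= n)%N -> forall G : 'M[R]_n, psd G ->
    (forall i : 'I_n, (m <= i)%N -> G i i = 0) -> 0 <= \tr (D *m G).
  by apply: (gen n) => // i; rewrite leqNgt ltn_ord.
elim: m => [|m IH] lmn {pG}G pG dG.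
  by rewrite (psd_diag_eq0 pG) ?mulmx0 ?mxtrace0 // => i; apply: dG.
pose k := Ordinal lmn.
have [gk|gk] := eqVneq (G k k) 0.
  apply: (IH (ltnW lmn)) => // i; rewrite leq_eqVlt => /orP[/eqP mi|]; last exact: dG.
  by rewrite (_ : i = k) //; apply: val_inj; rewrite /= -mi.
have gk0 : 0 < G k k by rewrite lt_def gk psd_diag_ge0.
have pS := psd_schur pG gk; set S := _ - _ in pS.
have -> : G = S + (G k k)^-1 *: (col k G *m (col k G)^T) by rewrite subrK.
rewrite mulmxDr mxtraceD -scalemxAr mxtraceZ trace_mul_rank1 addr_ge0 //; last first.
  by rewrite mulr_ge0 // invr_ge0 ltW.
have SE i : S i i = G i i - (G k k)^-1 * (G i k * G i k).
  by rewrite !mxE big_ord1 !mxE.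
apply: (IH (ltnW lmn)) => // i; rewrite leq_eqVlt => /orP[/eqP mi|mi].
  by rewrite (_ : i = k) ?SE ?mulKf ?subrr //; apply: val_inj; rewrite /= -mi.
apply/eqP; rewrite eq_le (psd_diag_ge0 i pS) andbT SE dG // sub0r oppr_le0.
by rewrite mulr_ge0 ?invr_ge0 ?(ltW gk0) // -expr2 sqr_ge0.
Qed.

(** * Lagrange multipliers on a convex cone *)

Lemma scalar_fun0 (R : realType) (X : lmodType R) (f : X -> R) : scalar f -> f 0 = 0.
Proof.
move=> lf; have := lf 1 0 0; rewrite scale1r addr0 mul1r => /eqP.
by rewrite -subr_eq0 opprD addNKr oppr_eq0 => /eqP.
Qed.

Lemma scalar_funD (R : realType) (X : lmodType R) (f : X -> R) :
  scalar f -> {morph f : x y / x + y}.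
Proof. by move=> lf x y; rewrite -[x]scale1r lf mul1r scale1r. Qed.

Lemma scalar_funZ (R : realType) (X : lmodType R) (f : X -> R) t x :
  scalar f -> f (t *: x) = t * f x.
Proof. by move=> lf; rewrite -[_ *: _]addr0 lf scalar_fun0 // addr0. Qed.

(** The multiplier has to separate the ratios [c x / a x] with [a x > 0] from those with [a x < 0];
    the supremum of the former does so. *)
Lemma lagrange_one (R : realType) (X : lmodType R) (P : X -> Prop) (a c : X -> R) :
  scalar a -> scalar c ->
  (forall x y, P x -> P y -> P (x + y)) ->
  (forall t x, 0 <= t -> P x -> P (t *: x)) ->
  (exists2 x, P x & a x < 0) ->
  (forall x, P x -> a x <= 0 -> c x <= 0) ->
  exists2 l : R, 0 <= l & forall x, P x -> c x <= l * a x.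
Proof.
move=> la lc PD PZ [y Py ay] ac.
have cross x z : P x -> P z -> 0 < a x -> a z < 0 -> c x / a x <= c z / a z.
  move=> Px Pz ax az.
  (* This conic combination is chosen so that [a] vanishes on it. *)
  have Pw : P ((- a z) *: x + a x *: z) by apply: PD; apply: PZ => //; lra.
  have := ac _ Pw; rewrite !scalar_funD ?scalar_funZ // => H.
  have {}H : - a z * c x + a x * c z <= 0 by apply: H; rewrite mulrC; lra.
  rewrite ler_pdivrMr // mulrAC ler_ndivlMr //; lra.
(* Adding 0 makes the set nonempty and its supremum nonnegative. *)
pose E := [set r : R | r = 0 \/ exists x, [/\ P x, 0 < a x & r = c x / a x]]%classic.
have ubE z : P z -> a z < 0 -> ubound E (c z / a z).
  move=> Pz az r [->|[x [Px ax ->]]]; last exact: cross.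
  by rewrite ler_ndivlMr // mul0r ac // ltW.
have supE : has_sup E by split; [exists 0; left | exists (c y / a y); apply: ubE].
have E0 : 0 <= sup E by apply: (ub_le_sup supE.2); left.
exists (sup E) => // x Px; have [ax|ax|ax] := ltgtP (a x) 0.
- by rewrite -ler_ndivlMr // (ge_sup supE.1) //; apply: ubE.
- by rewrite -ler_pdivrMr //; apply: (ub_le_sup supE.2); right; exists x.
- by rewrite ax mulr0 ac // ax.
Qed.

(** The first constraint is absorbed into the cone while the induction hypothesis supplies the other
    multipliers; it is then dualised alone against what is left of [c]. *)
Lemma lagrange_seq (R : realType) (X : lmodType R) (J : eqType) (s : seq J)
    (P : X -> Prop) (a : J -> X -> R) (c : X -> R) :
  (forall j, scalar (a j)) -> scalar c ->
  (forall x y, P x -> P y -> P (x + y)) ->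
  (forall t x, 0 <= t -> P x -> P (t *: x)) ->
  (exists2 x, P x & forall j, j \in s -> a j x < 0) ->
  (forall x, P x -> (forall j, j \in s -> a j x <= 0) -> c x <= 0) ->
  uniq s ->
  exists2 l : J -> R, forall j, 0 <= l j
    & forall x, P x -> c x <= \sum_(j <- s) l j * a j x.
Proof.
move=> la; elim: s P c => [|j s IH] P c lc PD PZ [y Py ay] ac.
  by exists (fun=> 0) => // x Px; rewrite big_nil ac.
case/andP=> js us.
pose P' x := P x /\ a j x <= 0.
have [||||//|l l0 cl] := IH P' c lc.
- by move=> x z [Px ax] [Pz az]; split; [exact: PD | rewrite scalar_funD //; lra].
- by move=> t x t0 [Px ax]; split; [exact: PZ | rewrite scalar_funZ // mulr_ge0_le0].
- exists y => [|k ks]; last by apply: ay; rewrite inE ks orbT.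
  by split=> //; apply/ltW/ay; rewrite inE eqxx.
- move=> x [Px ax] as0; apply: ac => // k; rewrite inE => /predU1P[->//|]; exact: as0.
pose c' x := c x - \sum_(k <- s) l k * a k x.
have lc' : scalar c'.
  move=> t u v; rewrite /c' lc.
  under eq_bigr => k _ do rewrite la mulrDr mulrCA.
  by rewrite big_split /= -mulr_sumr; ring.
have [|x Px ax|m m0 cm] := @lagrange_one R X P (a j) c' (la j) lc' PD PZ.
- by exists y => //; apply: ay; rewrite inE eqxx.
- by rewrite subr_le0; apply: cl.
exists (fun k => if k == j then m else l k) => [k|x Px]; first by case: ifP.
rewrite big_cons eqxx -lerBlDr; apply: le_trans (cm x Px); rewrite lerD2l lerN2.
by rewrite le_eqVlt; apply/orP; left; apply/eqP; apply: eq_big_seq => k ks;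
  case: eqP => // kj; rewrite -kj ks in js.
Qed.

(** * Interpolation constraints as quadratic expressions in [G] *)

Lemma trace_Amat (R : realType) (mu L : R) N (H : 'M[R]_N) G (i j : idx N) :
  G^T = G ->
  \tr (G *m Amat mu L H i j) =
  2^-1 * (L / (L - mu) * (2 * bil G (uvec R j) (hvec H i - hvec H j))
    + 1 / (L - mu) * bil G (uvec R i - uvec R j) (uvec R i - uvec R j)
    + mu / (L - mu) * (2 * bil G (uvec R i) (hvec H j - hvec H i))
    + L * mu / (L - mu) * bil G (hvec H i - hvec H j) (hvec H i - hvec H j)).
Proof.
move=> sG; rewrite /Amat /=.
rewrite -scalemxAr mxtraceZ !mulmxDr !mxtraceD -!scalemxAr !mxtraceZ !mulmxDr !mxtraceD.
rewrite !trace_mul_rank1 (bil_sym (hvec H i - hvec H j) (uvec R j) sG).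
by rewrite (bil_sym (hvec H j - hvec H i) (uvec R i) sG) -!mulr2n !mulr_natl.
Qed.

Lemma Amat_sym (R : realType) (mu L : R) N (H : 'M[R]_N) (i j : idx N) :
  (Amat mu L H i j)^T = Amat mu L H i j.
Proof.
have sum_sym n (u v : 'cV[R]_n) : (u *m v^T + v *m u^T)^T = u *m v^T + v *m u^T.
  by rewrite linearD /= !trmx_mul !trmxK addrC.
have rank1_sym n (u : 'cV[R]_n) : (u *m u^T)^T = u *m u^T by rewrite trmx_mul trmxK.
rewrite /Amat /=; do !rewrite ?linearZ ?[(_ + _ *: _)^T]linearD /=.
by rewrite !sum_sym !rank1_sym.
Qed.

Lemma Amat_diag (R : realType) (mu L : R) N (H : 'M[R]_N) (i : idx N) :
  Amat mu L H i i = 0.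
Proof. by rewrite /Amat !subrr trmx0 !(mulmx0, mul0mx, addr0, scaler0). Qed.

Lemma trace_AR (R : realType) N (G : 'M[R]_N.+2) :
  \tr (G *m AR R N) = G ord_max ord_max.
Proof.
by rewrite /AR -(mul_delta_mx (0 : 'I_1)) -[delta_mx 0 _]trmx_delta trace_mul_rank1 bil_delta.
Qed.

Lemma uvec_delta (R : realType) N (i : 'I_N.+1) :
  uvec R (Some i) = delta_mx (widen_ord (leqnSn _) i) 0.
Proof. by apply/colP => j; rewrite !mxE andbT. Qed.

Lemma grad_le_dist (R : realType) (mu L Rad : R) N (H : 'M[R]_N) G f (i : idx N) :
  0 <= mu -> mu < L -> primal_feasible mu L Rad H G f ->
  bil G (uvec R i) (uvec R i) <= (L + mu) ^+ 2 * bil G (hvec H i) (hvec H i).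
Proof.
move=> mu0 muL [cons _ [sG pG]].
have := lerD (cons i None) (cons None i); rewrite !trace_Amat //=.
have := pG (uvec R i - (L + mu) *: hvec H i).
have := pG (hvec H i); rewrite -!/(bil _ _ _).
rewrite !(subr0, sub0r) !(bilDl, bilDr, bilNl, bilNr, bilZl, bilZr, bil0l, bil0r).
rewrite (bil_sym (hvec H i) (uvec R i) sG).
set u := bil G (uvec R i) (uvec R i); set h := bil G (hvec H i) (hvec H i).
set w := bil G (uvec R i) (hvec H i).
move=> h0 sq c; rewrite addr0 in c.
have k0 : L - mu != 0 by rewrite subr_eq0 gt_eqF.
have {}c : (u - (L + mu) * w + L * mu * h) / (L - mu) <= 0.
  by apply: le_trans c; rewrite le_eqVlt; apply/orP; left; apply/eqP; field.
rewrite pmulr_lle0 ?invr_gt0 ?subr_gt0 // in c.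
have : 0 <= L * mu * h by rewrite !mulr_ge0 // (le_trans mu0) // ltW.
by move: sq; rewrite expr2; set a := L + mu in c *; set t := L * mu * h in c *; lra.
Qed.

(** * Boundedness of the primal objective *)

Definition bounded_on (R : realType) (T : Type) (S : T -> Prop) (l : T -> R) : Prop :=
  exists B, forall t, S t -> `|l t| <= B.

Lemma bounded_onD (R : realType) T (S : T -> Prop) (l m : T -> R) :
  bounded_on S l -> bounded_on S m -> bounded_on S (fun t => l t + m t).
Proof.
move=> [B hB] [B' hB']; exists (B + B') => t St.
by rewrite (le_trans (ler_normD _ _)) // lerD ?hB ?hB'.
Qed.

Lemma bounded_onZ (R : realType) T (S : T -> Prop) (l : T -> R) a :
  bounded_on S l -> bounded_on S (fun t => a * l t).
Proof. by move=> [B hB]; exists (`|a| * B) => t St; rewrite normrM ler_wpM2l ?hB. Qed.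

Lemma bounded_on_le (R : realType) T (S : T -> Prop) (l m : T -> R) :
  (forall t, S t -> `|l t| <= m t) -> bounded_on S m -> bounded_on S l.
Proof.
move=> lm [B hB]; exists B => t St; apply: le_trans (lm t St) _.
exact: le_trans (ler_norm _) (hB t St).
Qed.

Lemma bounded_on_sum (R : realType) T (S : T -> Prop) (I : finType) (l : I -> T -> R) :
  (forall i, bounded_on S (l i)) -> bounded_on S (fun t => \sum_i l i t).
Proof.
move=> hl; suff: bounded_on S (fun t => \sum_(i <- index_enum I) l i t) by [].
elim: (index_enum I) => [|i s IH].
  by exists 0 => t _; rewrite big_nil normr0.
have [B hB] := bounded_onD (hl i) IH; exists B => t St; rewrite big_cons; exact: hB.
Qed.

Definition feasible_pair (R : realType) (mu L Rad : R) N (H : 'M[R]_N)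
  (Gf : 'M[R]_N.+2 * 'cV[R]_N.+1) : Prop := primal_feasible mu L Rad H Gf.1 Gf.2.

(* The vectors whose squared length is bounded form a subspace containing the starting
   point and, by [grad_le_dist], the gradient [u_i] as soon as it contains the iterate [h_i]. *)
Lemma bounded_bil_self (R : realType) (mu L Rad : R) N (H : 'M[R]_N) w :
  0 <= mu -> mu < L ->
  bounded_on (feasible_pair mu L Rad H) (fun Gf => bil Gf.1 w w).
Proof.
move=> mu0 muL; pose bv w := bounded_on (feasible_pair mu L Rad H) (fun Gf => bil Gf.1 w w).
have bv0 : bv 0 by exists 0 => -[G f] _; rewrite bil0l normr0.
have bvD x y : bv x -> bv y -> bv (x + y).
  move=> bx byy; apply: (bounded_on_le _ (bounded_onD (bounded_onZ 2 bx) (bounded_onZ 2 byy))).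
  by move=> [G f] [_ _ pG] /=; rewrite ger0_norm ?psd_bilD_le //; apply: pG.2.
have bvZ a x : bv x -> bv (a *: x).
  move=> bx; apply: (bounded_on_le _ (bounded_onZ (a * a) bx)) => -[G f] [_ _ pG] /=.
  by rewrite ger0_norm ?bilZl ?bilZr ?mulrA // -expr2 mulr_ge0 ?sqr_ge0 //; apply: pG.2.
have bv_coord (x : 'cV[R]_N.+2) : (forall j, x j 0 != 0 -> bv (delta_mx j 0)) -> bv x.
  move=> hx; rewrite [x]matrix_sum_delta; apply: big_ind => // j _.
  rewrite big_ord1; have [->|/hx] := eqVneq (x j 0) 0; first by rewrite scale0r.
  exact: bvZ.
have bv_start : bv (delta_mx ord_max 0).
  exists (Rad ^+ 2) => -[G f] [_ /= + pG]; rewrite trace_AR bil_delta ger0_norm //.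
  exact: psd_diag_ge0.
have bv_grad m (mN : (m < N.+1)%N) : bv (uvec R (Some (Ordinal mN))).
  elim/ltn_ind: m mN => m IH mN.
  suff bh : bv (hvec H (Some (Ordinal mN))).
    apply: (bounded_on_le _ (bounded_onZ ((L + mu) ^+ 2) bh)) => -[G f] fG.
    rewrite ger0_norm; first exact: grad_le_dist fG.
    by case: fG => _ _ pG; apply: pG.2.
  (* The iterate involves only the starting point and gradients of index below [m], which the strong
     induction covers. *)
  apply: bv_coord => j; rewrite mxE; have [->//|_] := eqVneq j ord_max.
  case: ltnP => [/= jm _|]; last by rewrite eqxx.
  have := IH j jm (ltn_trans jm mN); rewrite uvec_delta.
  by congr (bv (delta_mx _ _)); apply: val_inj.
apply: bv_coord => j _; have [->//|jN] := eqVneq j ord_max.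
have {}jN : (j < N.+1)%N by rewrite ltn_neqAle jN -ltnS ltn_ord.
have := bv_grad _ jN; rewrite uvec_delta.
by congr (bv (delta_mx _ _)); apply: val_inj.
Qed.

Lemma bounded_bil (R : realType) (mu L Rad : R) N (H : 'M[R]_N) x y :
  0 <= mu -> mu < L ->
  bounded_on (feasible_pair mu L Rad H) (fun Gf => bil Gf.1 x y).
Proof.
move=> mu0 muL.
apply: (bounded_on_le _ (bounded_onD (bounded_bil_self Rad H x mu0 muL)
                                     (bounded_bil_self Rad H y mu0 muL))).
by move=> [G f] [_ _ pG]; apply: psd_bil_le.
Qed.

Lemma bounded_trace (R : realType) (mu L Rad : R) N (H : 'M[R]_N) (C : 'M[R]_N.+2) :
  0 <= mu -> mu < L ->
  bounded_on (feasible_pair mu L Rad H) (fun Gf => \tr (C *m Gf.1)).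
Proof.
move=> mu0 muL.
have [B hB] : bounded_on (feasible_pair mu L Rad H)
    (fun Gf => \sum_i \sum_j C i j * bil Gf.1 (delta_mx j 0) (delta_mx i 0)).
  by do 2![apply: bounded_on_sum => ?]; apply: bounded_onZ; apply: bounded_bil.
exists B => Gf fG; have := hB Gf fG; rewrite /mxtrace.
under eq_bigr => i _ do under eq_bigr => j _ do rewrite bil_delta.
by under [in X in _ -> X]eq_bigr => i _ do rewrite mxE.
Qed.

Lemma bounded_primal_obj (R : realType) (mu L Rad : R) N (H : 'M[R]_N) b C :
  0 <= mu -> mu < L ->
  bounded_on (feasible_pair mu L Rad H) (fun Gf => primal_obj b C Gf.1 Gf.2).
Proof.
move=> mu0 muL; apply: bounded_onD; last exact: bounded_trace.
have [B hB] : bounded_on (feasible_pair mu L Rad H) (fun Gf => \sum_i b i 0 * Gf.2 i 0).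
  apply: bounded_on_sum => i; apply: bounded_onZ.
  (* The two constraints linking [i] and [*] trap the [i]-th function value between two bounded
     traces. *)
  have [B hB] := bounded_trace Rad H (Amat mu L H (Some i) None) mu0 muL.
  have [B' hB'] := bounded_trace Rad H (Amat mu L H None (Some i)) mu0 muL.
  exists (B + B') => -[G f] fG /=; have := hB _ fG; have := hB' _ fG => /=.
  case: fG => cons _ _; have := cons (Some i) None; have := cons None (Some i).
  rewrite /= ![\tr (G *m _)]mxtrace_mulC subr0 sub0r !ler_norml.
  by move=> ? ? /andP[? ?] /andP[? ?]; apply/andP; split; lra.
exists B => Gf fG; have := hB Gf fG; rewrite mxE.
by under [in X in _ -> X]eq_bigr => i _ do rewrite mxE.
Qed.

(** * Weak duality *)

Lemma dual_combination_dot (R : realType) N (lam : idx N -> idx N -> R) (f : 'cV[R]_N.+1) :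
  ((\sum_i \sum_j lam i j *: (vvec R j - vvec R i))^T *m f) 0 0
  = \sum_i \sum_j lam i j * (fval f j - fval f i).
Proof.
have fE (i : idx N) : ((vvec R i)^T *m f) 0 0 = fval f i.
  case: i => [i|] /=; last by rewrite trmx0 mul0mx mxE.
  rewrite mxE (bigD1 i) //= big1 ?addr0 => [|k ki]; rewrite !mxE ?eqxx ?mul1r //.
  by rewrite (negPf ki) mul0r.
rewrite linear_sum mulmx_suml summxE; apply: eq_bigr => i _.
rewrite linear_sum mulmx_suml summxE; apply: eq_bigr => j _.
by rewrite /= linearZ /= -scalemxAl mxE linearB /= mulmxBl mxE [in X in _ + X]mxE !fE.
Qed.

Lemma weak_duality (R : realType) (mu L Rad : R) N (H : 'M[R]_N) b C lam tau G f :
  primal_feasible mu L Rad H G f -> dual_feasible mu L H b C lam tau ->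
  primal_obj b C G f <= tau * Rad ^+ 2.
Proof.
move=> [cons radG pG] [[_ pD] /subr0_eq bE lam0 tau0].
have := psd_trace_ge0 pD pG.
rewrite !(mulmxDl, mulNmx, mxtraceD) raddfN /= -scalemxAl mxtraceZ mxtrace_mulC => trD.
have : \sum_i \sum_j lam i j * (fval f j - fval f i + \tr (G *m Amat mu L H i j)) <= 0.
  by do 2![apply: sumr_le0 => ? _]; rewrite mulr_ge0_le0.
have trS : \tr ((\sum_i \sum_j lam i j *: Amat mu L H i j) *m G)
    = \sum_i \sum_j lam i j * \tr (G *m Amat mu L H i j).
  rewrite mulmx_suml raddf_sum; apply: eq_bigr => i _.
  rewrite mulmx_suml raddf_sum; apply: eq_bigr => j _.
  by rewrite /= -scalemxAl mxtraceZ mxtrace_mulC.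
under eq_bigr => i _ do (under eq_bigr => j _ do rewrite mulrDr); rewrite /primal_obj bE.
rewrite dual_combination_dot.
under eq_bigr => i _ do rewrite big_split /=.
rewrite big_split /=; move: trD (ler_wpM2l tau0 radG); rewrite trS; lra.
Qed.

(** * A strictly feasible point from a one-dimensional quadratic *)

(** At [kappa], [p i] is the factor relating the [i]-th iterate to the starting point on the
    quadratic with curvature [kappa]. Since the recurrence uses all earlier terms, a growing list of
    polynomials is iterated. *)
Lemma exists_iterate_poly (R : realType) (h : nat -> nat -> R) :
  exists p : nat -> {poly R},
    forall i, p i = 1 - 'X * \sum_(k < i) h i k *: p k.
Proof.
pose step s := rcons s (1 - 'X * \sum_(k < size s) h (size s) k *: s`_k : {poly R}).
pose ps n := iter n step [::].
have sz n : size (ps n) = n by elim: n => //= n IH; rewrite size_rcons IH.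
have stab k n : (k < n)%N -> (ps n)`_k = (ps k.+1)`_k.
  elim: n => // n IH; rewrite ltnS leq_eqVlt => /predU1P[->//|kn].
  by rewrite -IH //= nth_rcons sz kn.
exists (fun i => (ps i.+1)`_i) => i.
rewrite /= nth_rcons sz ltnn eqxx; congr (1 - _ * _).
by apply: eq_bigr => k _; rewrite stab.
Qed.

(** Only the term in [p i] reaches the top degree of [p i.+1], and its coefficient [h i.+1 i] is
    nonzero. *)
Lemma size_iterate_poly (R : realType) N (h : nat -> nat -> R) (p : nat -> {poly R}) :
  (forall i, p i = 1 - 'X * \sum_(k < i) h i k *: p k) ->
  (forall i, (i < N)%N -> h i.+1 i != 0) ->
  forall i, (i <= N)%N -> size (p i) = i.+1.
Proof.
move=> pE hn0; elim/ltn_ind => -[|i] IH iN.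
  by rewrite pE big_ord0 mulr0 subr0 size_poly1.
rewrite pE big_ord_recr /=.
have szi : size (h i.+1 i *: p i) = i.+1 by rewrite size_scale ?hn0 // IH // ltnW.
have szs : (size (\sum_(k < i) h i.+1 k *: p k)%R <= i)%N.
  rewrite (leq_trans (size_sum _ _ _)) //; apply/bigmax_leqP => k _.
  rewrite (leq_trans (size_scale_leq _ _)) //.
  have ki := ltn_ord k.
  by rewrite IH ?ltnS // ltnW // (leq_trans ki) // ltnW.
have sz : size (\sum_(k < i) h i.+1 k *: p k + h i.+1 i *: p i) = i.+1.
  by rewrite addrC size_polyDl ?szi // ltnS.
have szX : size ('X * (\sum_(k < i) h i.+1 k *: p k + h i.+1 i *: p i)) = i.+2.
  by rewrite mulrC size_mulX ?sz // -size_poly_eq0 sz.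
by rewrite [1 - _]addrC size_polyDl size_polyN szX // size_poly1.
Qed.

Lemma exists_nonroot_itv (R : realType) (p : {poly R}) (a b : R) :
  p != 0 -> a < b -> exists2 k, a < k < b & ~~ root p k.
Proof.
(* These give [size p] distinct points, more than [p] has roots; a denominator of at least 2 keeps
   them strictly below [b]. *)
move=> p0 ab; pose x n : R := a + (b - a) / n.+2%:R.
pose s := [seq x n | n <- iota 0 (size p)].
have us : uniq s.
  rewrite map_inj_uniq ?iota_uniq // => m n /addrI /mulfI.
  rewrite subr_eq0 gt_eqF // => /(_ isT) /invr_inj /eqP.
  by rewrite eqr_nat => /eqP [].
have /allPn [k /mapP [n _ ->] nr] : ~~ all (root p) s.
  apply/negP => rs; have := max_poly_roots p0 rs us.
  by rewrite size_map size_iota ltnn.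
exists (x n) => //; have n0 : 0 < n.+2%:R :> R by rewrite ltr0n.
rewrite /x ltrDl divr_gt0 ?subr_gt0 //= -ltrBrDl ltr_pdivrMr //.
by rewrite ltr_pMr ?subr_gt0 // ltr1n.
Qed.

(** The left side is the interpolation constraint for the quadratic with curvature [k] at points [x]
    and [y]. The right side is negative when [mu < k < L] and [x] differs from [y]. *)
Lemma quadratic_slack (R : realType) (mu L k x y : R) : mu < L ->
  k / 2 * y ^+ 2 - k / 2 * x ^+ 2
  + 2^-1 * (L / (L - mu) * (2 * (k * y * (x - y)))
    + 1 / (L - mu) * ((k * x - k * y) * (k * x - k * y))
    + mu / (L - mu) * (2 * (k * x * (y - x)))
    + L * mu / (L - mu) * ((x - y) * (x - y)))
  = - ((k - mu) * (L - k) / (L - mu) / 2 * (x - y) ^+ 2).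
Proof. by move=> muL; field; rewrite subr_eq0 gt_eqF. Qed.

(** Row [i] of [H] stores step [i.+1], so the condition on the coefficients [h_{i,i-1}] is a
    condition on the diagonal of [H]. *)
Lemma hc_subdiag (R : realType) N (H : 'M[R]_N) (i : nat) (iN : (i < N)%N) :
  hc H i.+1 i = H (Ordinal iN) (Ordinal iN).
Proof. by rewrite /hc /= insubT. Qed.

Lemma slater_point (R : realType) (mu L Rad : R) N (H : 'M[R]_N) :
  mu < L -> 0 < Rad -> (forall i : 'I_N, H i i != 0) ->
  exists (G : 'M[R]_N.+2) (f : 'cV[R]_N.+1),
    [/\ psd G, \tr (G *m AR R N) < Rad ^+ 2
      & forall i j : idx N, i != j ->
          fval f j - fval f i + \tr (G *m Amat mu L H i j) < 0].
Proof.
move=> muL Rad0 Hd; have [p pE] := exists_iterate_poly (hc H).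
have szp : forall i, (i <= N)%N -> size (p i) = i.+1.
  by apply: (size_iterate_poly pE) => i iN; rewrite (hc_subdiag H iN).
(* The minimiser is 0, so the zero polynomial stands for [*], and distinctness of the [P i] also
   makes the iterates nonzero. *)
pose P (i : idx N) : {poly R} := if i is Some i then p i else 0.
have szP i : size (P (Some i)) = i.+1 by rewrite szp // -ltnS ltn_ord.
have Pinj i j : i != j -> P i - P j != 0.
  apply: contra_neq => /subr0_eq /(congr1 (fun q : {poly R} => size q)).
  case: i j => [i|] [j|] //; rewrite ?szP ?size_poly0 //.
  by case=> /val_inj ->.
(* A non-root of the product of all differences separates every pair at once. *)
have [|k /andP [muk kL] nr] :=
    @exists_nonroot_itv R (\prod_i \prod_(j | i != j) (P i - P j)) mu L _ muL.
  by do 2![apply/prodf_neq0 => ? ?]; exact: Pinj.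
have Pk i j : i != j -> (P i).[k] != (P j).[k].
  move=> ij; apply: contra nr => /eqP Pij; rewrite /root horner_prod.
  by rewrite (bigD1 i) //= horner_prod (bigD1 j) //= !hornerE Pij subrr !mul0r.
(* Starting at half the radius makes the radius constraint strict. The vector [z] lists the
   gradients [k * X i], then the starting point; [inord] is read only at indices in its range. *)
pose rho := Rad / 2; pose X i := rho * (P i).[k].
pose z : 'cV[R]_N.+2 := \col_j (if j == ord_max then rho else k * X (Some (inord j))).
have zu i : (z^T *m uvec R i) 0 0 = k * X i.
  case: i => [i|]; last by rewrite /= mulmx0 mxE /X horner0 !mulr0.
  rewrite uvec_delta -colE !mxE ifN ?inord_val //.
  by rewrite -val_eqE /= neq_ltn ltn_ord.
have zh i : (z^T *m hvec H i) 0 0 = X i.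
  case: i => [i|]; last by rewrite /= mulmx0 mxE /X horner0 mulr0.
  rewrite mxE big_ord_recr /= !mxE eqxx mulr1 /X /= pE !hornerE horner_sum.
  rewrite addrC mulrBr mulr1 !mulr_sumr -sumrN.
  rewrite (big_ord_widen N.+1 (fun j => - (rho * (k * (hc H i j *: p j).[k])))); last first.
    exact: ltnW.
  rewrite [in RHS]big_mkcond; congr (_ + _); apply: eq_bigr => j _; rewrite !mxE.
  rewrite ifN; last by rewrite -val_eqE /= neq_ltn ltn_ord.
  rewrite (ifN _ _ (_ : widen_ord _ j != ord_max)); last by rewrite -val_eqE /= neq_ltn ltn_ord.
  case: ifP => _ /=; last by rewrite mulr0.
  by rewrite inord_val /X hornerZ /=; ring.
exists (z *m z^T), (\col_i (k / 2 * X (Some i) ^+ 2)).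
have fE i : fval (\col_i (k / 2 * X (Some i) ^+ 2)) i = k / 2 * X i ^+ 2.
  by case: i => [i|]; rewrite /= ?mxE // /X horner0 mulr0 expr0n mulr0.
split; first exact: psd_rank1.
  by rewrite trace_AR !mxE big_ord1 !mxE eqxx /rho; nra.
move=> i j ij; rewrite trace_Amat; last by rewrite trmx_mul trmxK.
have lin a c : (z^T *m (a - c)) 0 0 = (z^T *m a) 0 0 - (z^T *m c) 0 0.
  by rewrite mulmxBr mxE [in X in _ + X]mxE.
rewrite !bil_rank1 !lin !zu !zh !fE quadratic_slack // oppr_lt0.
apply: mulr_gt0; first by rewrite !(divr_gt0, mulr_gt0) ?subr_gt0 ?ltr0n.
rewrite exprn_even_gt0 //= subr_eq0 /X (inj_eq (mulfI _)) ?Pk //.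
by rewrite /rho gt_eqF // divr_gt0.
Qed.

(** * Homogenisation and extraction of dual multipliers *)

Lemma fvalD (R : realType) N (f g : 'cV[R]_N.+1) (i : idx N) :
  fval (f + g) i = fval f i + fval g i.
Proof. by case: i => [i|] /=; rewrite ?mxE ?addr0. Qed.

Lemma fvalZ (R : realType) N t (f : 'cV[R]_N.+1) (i : idx N) :
  fval (t *: f) i = t * fval f i.
Proof. by case: i => [i|] /=; rewrite ?mxE ?mulr0. Qed.

Lemma primal_obj_lin (R : realType) N b C t (G G' : 'M[R]_N.+2) (f f' : 'cV[R]_N.+1) :
  primal_obj b C (t *: G + G') (t *: f + f')
  = t * primal_obj b C G f + primal_obj b C G' f'.
Proof.
rewrite /primal_obj !mulmxDr -!scalemxAr mxtraceD mxtraceZ.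
by move: (b^T *m f) (b^T *m f') => u v; rewrite !mxE; ring.
Qed.

Lemma primal_objZ (R : realType) N b C t (G : 'M[R]_N.+2) (f : 'cV[R]_N.+1) :
  primal_obj b C (t *: G) (t *: f) = t * primal_obj b C G f.
Proof.
by rewrite /primal_obj -!scalemxAr mxtraceZ mxE mulrDr.
Qed.

Definition interp_slack (R : realType) (mu L : R) N (H : 'M[R]_N)
    (G : 'M[R]_N.+2) (f : 'cV[R]_N.+1) (i j : idx N) : R :=
  fval f j - fval f i + \tr (G *m Amat mu L H i j).

Lemma interp_slack_lin (R : realType) (mu L : R) N (H : 'M[R]_N) t G G' f f' i j :
  interp_slack mu L H (t *: G + G') (t *: f + f') i j
  = t * interp_slack mu L H G f i j + interp_slack mu L H G' f' i j.
Proof.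
rewrite /interp_slack !fvalD !fvalZ mulmxDl -scalemxAl mxtraceD mxtraceZ; ring.
Qed.

Lemma interp_slackZ (R : realType) (mu L : R) N (H : 'M[R]_N) t G f i j :
  interp_slack mu L H (t *: G) (t *: f) i j = t * interp_slack mu L H G f i j.
Proof.
by rewrite /interp_slack !fvalZ -scalemxAl mxtraceZ mulrDr mulrBr.
Qed.

Lemma interp_slack_diag (R : realType) (mu L : R) N (H : 'M[R]_N) G f i :
  interp_slack mu L H G f i i = 0.
Proof. by rewrite /interp_slack subrr Amat_diag mulmx0 mxtrace0 addr0. Qed.

(* For [t = 0] the point spans a feasible ray, along which the bounded objective cannot
   increase. *)
Lemma primal_obj_homog_le (R : realType) (mu L Rad p : R) N (H : 'M[R]_N) b C t G f :
  (forall G f, primal_feasible mu L Rad H G f -> primal_obj b C G f <= p) ->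
  0 <= t -> psd G -> \tr (G *m AR R N) <= t * Rad ^+ 2 ->
  (forall i j, interp_slack mu L H G f i j <= 0) ->
  primal_obj b C G f <= t * p.
Proof.
move=> ubp t0 pG radG cons.
have scaled s : 0 <= s -> s * t <= 1 -> s * primal_obj b C G f <= p.
  move=> s0 st; rewrite -primal_objZ; apply: ubp; split; last exact: psdZ.
    by move=> i j; rewrite -/(interp_slack _ _ _ _ _ _ _) interp_slackZ mulr_ge0_le0.
  rewrite -scalemxAl mxtraceZ (le_trans (ler_wpM2l s0 radG)) // mulrA.
  by rewrite ler_piMl // sqr_ge0.
have [tp|] := ltP 0 t.
  by rewrite mulrC -ler_pdivrMr // mulrC scaled ?invr_ge0 // mulVf // gt_eqF.
move=> t_le0; have {t_le0}t0 : t = 0 by apply/eqP; rewrite eq_le t_le0 t0.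
rewrite t0 mul0r leNgt; apply/negP => obj0.
have p0 : 0 <= p by rewrite -(mul0r (primal_obj b C G f)) scaled ?mul0r ?ler01.
(* Scaling by this factor would give the objective value [p + 1], above the bound [p]. *)
have s0 : 0 <= (p + 1) / primal_obj b C G f.
  by apply: divr_ge0; [lra | exact: ltW].
by have := scaled _ s0; rewrite t0 mulr0 divfK ?gt_eqF // ler01 => /(_ isT); lra.
Qed.

Lemma exists_multipliers (R : realType) (mu L Rad p : R) N (H : 'M[R]_N) b C :
  mu < L -> 0 < Rad -> (forall i : 'I_N, H i i != 0) ->
  (forall G f, primal_feasible mu L Rad H G f -> primal_obj b C G f <= p) ->
  exists (lam : idx N -> idx N -> R) (tau : R),
    [/\ forall i j, 0 <= lam i j, 0 <= tau
      & forall t G f, 0 <= t -> psd G ->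
          primal_obj b C G f - t * p
          <= tau * (\tr (G *m AR R N) - t * Rad ^+ 2)
             + \sum_i \sum_j lam i j * interp_slack mu L H G f i j].
Proof.
move=> muL Rad0 Hd ubp.
pose X : lmodType R := (R^o * 'M[R]_N.+2 * 'cV[R]_N.+1)%type.
pose P (x : X) := 0 <= x.1.1 /\ psd x.1.2.
pose c (x : X) : R := primal_obj b C x.1.2 x.2 - x.1.1 * p.
pose a (j : option (idx N * idx N)) (x : X) : R :=
  if j is Some ij then interp_slack mu L H x.1.2 x.2 ij.1 ij.2
  else \tr (x.1.2 *m AR R N) - x.1.1 * Rad ^+ 2.
(* [None] is the radius constraint. Diagonal pairs are left out because their slack is identically 0
   and so never strictly negative. *)
pose s := None :: [seq Some ij | ij <- enum {: idx N * idx N} & ij.1 != ij.2].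
have [||||||| l l0 cl] := @lagrange_seq R X _ s P a c.
- move=> [[i j]|] t [[t1 G1] f1] [[t2 G2] f2]; rewrite /a /=; first exact: interp_slack_lin.
  by rewrite mulmxDl -scalemxAl mxtraceD mxtraceZ; rewrite /GRing.scale /=; ring.
- move=> t [[t1 G1] f1] [[t2 G2] f2]; rewrite /c /= primal_obj_lin.
  by rewrite /GRing.scale /=; ring.
- move=> x y [x0 px] [y0 py]; split; [exact: addr_ge0 | exact: psdD].
- by move=> t x t0 [x0 px]; split; [exact: mulr_ge0 | exact: psdZ].
- have [G [f [pG radG strict]]] := slater_point muL Rad0 Hd.
  exists (1, G, f) => [|j]; first by split=> //=; exact: ler01.
  rewrite inE => /predU1P[->|/mapP [[i j'] + ->]]; first by rewrite /a /= mul1r subr_lt0.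
  by rewrite mem_filter => /andP[ij _]; apply: strict.
- move=> [[t G] f] [/= t0 pG] cons; rewrite /c /= subr_le0.
  apply: (primal_obj_homog_le ubp) => //.
    by have := cons None; rewrite inE eqxx /a /= subr_le0; apply.
  move=> i j; have [<-|ij] := eqVneq i j; first by rewrite interp_slack_diag.
  apply: (cons (Some (i, j))); rewrite inE map_f ?orbT // mem_filter ij.
  by rewrite mem_enum.
- rewrite cons_uniq map_inj_uniq => [|x y [->]//]; apply/andP; split.
    by apply/mapP => -[].
  exact/filter_uniq/enum_uniq.
exists (fun i j => l (Some (i, j))), (l None); split=> // t G f t0 pG.
have := cl (t, G, f) (conj t0 pG); rewrite /c big_cons /a /=.
rewrite big_map big_filter big_enum_cond /= pair_bigA /=; congr (_ <= _ + _).
rewrite [LHS]big_mkcond; apply: eq_bigr => -[i j] _ /=.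
by case: eqVneq => //= ->; rewrite interp_slack_diag mulr0.
Qed.

(** The Lagrangian inequality is tested at three kinds of points [(t, G, f)]: [(1, 0, 0)] bounds the
    dual value, [(0, x x^T, 0)] gives the matrix inequality, and [(0, 0, f)] gives the linear
    equation. *)
Lemma exists_dual_feasible (R : realType) (mu L Rad p : R) N (H : 'M[R]_N) b C :
  mu < L -> 0 < Rad -> (forall i : 'I_N, H i i != 0) -> C^T = C ->
  (forall G f, primal_feasible mu L Rad H G f -> primal_obj b C G f <= p) ->
  exists (lam : idx N -> idx N -> R) (tau : R),
    dual_feasible mu L H b C lam tau /\ tau * Rad ^+ 2 <= p.
Proof.
move=> muL Rad0 Hd sC ubp.
have [lam [tau [lam0 tau0 lag]]] := exists_multipliers muL Rad0 Hd ubp.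
exists lam, tau; split; last first.
  have := lag 1 0 0 ler01 (psd_zero _ _).
  rewrite /primal_obj !mulmx0 mul0mx mxtrace0 mxE.
  rewrite big1 => [|i _]; last first.
    rewrite big1 // => j _.
    by rewrite -(scale0r (0 : 'M[R]_N.+2)) -(scale0r (0 : 'cV[R]_N.+1)) interp_slackZ mul0r mulr0.
  by rewrite !mul1r; lra.
split=> //.
- split.
    rewrite !linearD /= linearN linearZ /= sC trmx_delta linear_sum /=; congr (_ + _).
    apply: eq_bigr => i _; rewrite linear_sum; apply: eq_bigr => j _.
    by rewrite /= linearZ /= Amat_sym.
  move=> x; rewrite -/(bil _ x x) -trace_mul_rank1 mxtrace_mulC.
  have := lag 0 _ 0 (lexx 0) (psd_rank1 x).
  rewrite /primal_obj mulmx0 mxE add0r !mul0r !subr0.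
  rewrite !mulmxDr mulmxN !mxtraceD (raddfN (@mxtrace R _)) /= -scalemxAr mxtraceZ.
  rewrite [\tr (C *m _)]mxtrace_mulC.
  suff -> : \sum_i \sum_j lam i j * interp_slack mu L H (x *m x^T) 0 i j
    = \tr (x *m x^T *m \sum_i \sum_j lam i j *: Amat mu L H i j) by lra.
  rewrite mulmx_sumr raddf_sum; apply: eq_bigr => i _.
  rewrite mulmx_sumr raddf_sum; apply: eq_bigr => j _ /=.
  rewrite -scalemxAr mxtraceZ /interp_slack.
  by rewrite -(scale0r (0 : 'cV[R]_N.+1)) !fvalZ !mul0r subrr add0r.
- set d := b - _; have dE (f : 'cV[R]_N.+1) : (d^T *m f) 0 0 <= 0.
    rewrite /d linearB /= mulmxBl mxE [in X in _ + X]mxE dual_combination_dot subr_le0.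
    have := lag 0 0 f (lexx 0) (psd_zero _ _).
    rewrite /primal_obj mulmx0 mul0mx mxtrace0 !mul0r !subr0 mulr0 addr0 add0r.
    congr (_ <= _); apply: eq_bigr => i _; apply: eq_bigr => j _.
    by rewrite /interp_slack mul0mx mxtrace0 addr0.
  apply/colP => i; rewrite [RHS]mxE; apply/eqP; rewrite eq_le.
  have dd e : (d^T *m (e *: delta_mx i (0 : 'I_1))) 0 0 = e * d i 0.
    by rewrite -scalemxAr -colE !mxE.
  (* A linear functional that is nonpositive on both signs of each basis vector vanishes. *)
  have := dE (1 *: delta_mx i 0); have := dE (-1 *: delta_mx i 0); rewrite !dd.
  by move=> ? ?; apply/andP; split; lra.
Qed.

(** * Dual attainment and equality of the optimal values *)

Theorem theorem6 (R : realType) (mu L Rad : R) (N : nat) (H : 'M[R]_N)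
  (b : 'cV[R]_(N.+1)) (C : 'M[R]_(N.+2)) :
  0 <= mu -> mu < L -> (1 <= N)%N -> 0 < Rad ->
  is_trig_mx H ->
  (forall i : 'I_N, H i i != 0) ->
  C^T = C ->
  exists (lam : idx N -> idx N -> R) (tau : R),
    [/\ dual_feasible mu L H b C lam tau,
        (forall (lam' : idx N -> idx N -> R) (tau' : R),
           dual_feasible mu L H b C lam' tau' -> tau * Rad ^+ 2 <= tau' * Rad ^+ 2)
      & w_sdp mu L Rad H b C = (tau * Rad ^+ 2)%:E].
Proof.
move=> mu0 muL _ Rad0 _ Hd sC.
pose F := [set Gf : 'M[R]_N.+2 * 'cV[R]_N.+1 | primal_feasible mu L Rad H Gf.1 Gf.2]%classic.
pose V := [set primal_obj b C Gf.1 Gf.2 | Gf in F]%classic.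
(* The strictly feasible point gives nonemptiness, so the primal value is the real number
   [sup V]. *)
have supV : has_sup V.
  split.
    have [G [f [pG radG strict]]] := slater_point muL Rad0 Hd.
    exists (primal_obj b C G f), (G, f) => //; split=> //=; last exact: ltW.
    move=> i j; have [<-|/strict /ltW //] := eqVneq i j.
    by rewrite -/(interp_slack _ _ _ _ _ _ _) interp_slack_diag.
  have [B hB] := bounded_primal_obj Rad H b C mu0 muL.
  by exists B => _ [Gf fG <-]; apply: le_trans (ler_norm _) (hB _ fG).
have ubV G f : primal_feasible mu L Rad H G f -> primal_obj b C G f <= sup V.
  by move=> fG; apply: (ub_le_sup supV.2); exists (G, f).
have [lam [tau [dual tau_le]]] := exists_dual_feasible muL Rad0 Hd sC ubV.
have weak lam' tau' : dual_feasible mu L H b C lam' tau' -> sup V <= tau' * Rad ^+ 2.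
  by move=> d'; apply: (ge_sup supV.1) => _ [[G f] fG <-]; apply: weak_duality d'.
(* The multipliers built from the bound [sup V] have dual value at most [sup V]; weak duality gives
   the reverse. *)
have supE : sup V = tau * Rad ^+ 2 by apply/le_anti; rewrite tau_le (weak lam tau).
exists lam, tau; split=> // [lam' tau' d'|]; first by rewrite -supE (weak lam').
rewrite -supE -(ereal_sup_EFin supV.2 supV.1) /w_sdp.
by congr ereal_sup; rewrite image_comp.
Qed.
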